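(* Let $R$ be a (not necessarily commutative) ring, $M$ a nonzero strongly F-regular right $R$-module and $S=\mathrm{End}_R(M)$. The following statements are equivalent: (1) $M$ is a morphic $R$-module and $S$ is a reduced ring; (2) $M$ is a duo $R$-module; (3) $M$ is an Abelian endoregular $R$-module.
   Context: Rings are associative and unital; modules are unitary. - $M$ is strongly F-regular if every finitely generated submodule of $M$ is a direct summand of $M$. - $M$ is morphic if $M/\varphi(M)\cong\ker(\varphi)$ as $R$-modules for every $\varphi\in \mathrm{End}_R(M)$. - A ring is reduced if it has no nonzero nilpotent elements. - $M$ is duo if $\varphi(N)\subseteq N$ for every submodule $N$ of $M$ and every $\varphi\in\mathrm{End}_R(M)$. - A ring $T$ is strongly regular if for each $a\in T$ there is $y\in T$ with $a=a^2y$. - $M$ is Abelian endoregular if $\mathrm{End}_R(M)$ is a strongly regular ring. *)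

(* Defs.v *)
From HB Require Import structures.
From mathcomp Require Import all_boot all_algebra.
From mathcomp Require Import boolp.

Set Implicit Arguments.
Unset Strict Implicit.
Unset Printing Implicit Defensive.

Import GRing.Theory.
Local Open Scope ring_scope.
Local Open Scope quotient_scope.

(* Everything is stated for left modules over a ring [A]; a right [R]-module
   is an [lmodType R^c], where [a *: m] stands for the product of [m] by [a]
   on the right. *)

(* A submodule of [M] is an [N : submodClosed M].  Such an [N] is a boolean
   predicate, but since [boolp] turns every proposition into a boolean, all the
   submodules of [M] are of this form. *)

(* [submodClosed] makes sense over semirings, so it does not provide closure
   under opposite; this alias does, as needed for quotients and submodule
   types. *)
Section SubmodulePredicate.
Context (A : pzRingType) (M : lmodType A) (N : submodClosed M).

Definition submod_pred : {pred M} := N.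

HB.instance Definition _ :=
  GRing.isSubmodClosed.Build A M submod_pred (submodClosedP N).
End SubmodulePredicate.

Section SubmoduleType.
Context (A : pzRingType) (M : lmodType A) (N : submodClosed M).

Record submod_of := SubmodOf {
  submod_val :> M;
  submod_valP : submod_val \in submod_pred N }.

HB.instance Definition _ := [isSub for submod_val].
HB.instance Definition _ := [Choice of submod_of by <:].
HB.instance Definition _ := [SubChoice_isSubLmodule of submod_of by <:].
End SubmoduleType.

Section QuotientModule.
Context (A : pzRingType) (M : lmodType A) (N : submodClosed M).

(* The library equips [{quot N}] with its additive group structure only. *)
Definition quotmod := Quotient.quot (submod_pred N).

HB.instance Definition _ := GRing.Zmodule.on quotmod.

Definition quotmod_pi (x : M) : quotmod :=
  \pi_(Quotient.quot (submod_pred N)) x.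

Definition quotmod_scale (a : A) (u : quotmod) : quotmod :=
  quotmod_pi (a *: repr u).

Lemma quotmod_piP (u : quotmod) : exists x, u = quotmod_pi x.
Proof. by exists (repr u); rewrite /quotmod_pi reprK. Qed.

Lemma eq_quotmod_pi x y : (quotmod_pi x == quotmod_pi y) = (x - y \in N).
Proof. by rewrite -Quotient.idealrBE. Qed.

Lemma quotmod_piD : {morph quotmod_pi : x y / x + y}.
Proof. exact: Quotient.pi_add. Qed.

Lemma quotmod_scale_pi a x :
  quotmod_scale a (quotmod_pi x) = quotmod_pi (a *: x).
Proof.
apply/eqP; rewrite eq_quotmod_pi -scalerBr.
by apply: rpredZ; rewrite -eq_quotmod_pi /quotmod_pi reprK.
Qed.

Fact quotmod_scaleA a b u :
  quotmod_scale a (quotmod_scale b u) = quotmod_scale (a * b) u.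
Proof. by have [x ->] := quotmod_piP u; rewrite !quotmod_scale_pi scalerA. Qed.

Fact quotmod_scale1 : left_id 1 quotmod_scale.
Proof.
by move=> u; have [x ->] := quotmod_piP u; rewrite quotmod_scale_pi scale1r.
Qed.

Fact quotmod_scaleDr : right_distributive quotmod_scale +%R.
Proof.
move=> a u v; have [x ->] := quotmod_piP u; have [y ->] := quotmod_piP v.
by rewrite -quotmod_piD !quotmod_scale_pi -quotmod_piD scalerDr.
Qed.

Fact quotmod_scaleDl u : {morph quotmod_scale^~ u : a b / a + b}.
Proof.
move=> a b; have [x ->] := quotmod_piP u.
by rewrite !quotmod_scale_pi -quotmod_piD scalerDl.
Qed.

HB.instance Definition _ := GRing.Zmodule_isLmodule.Build A quotmod
  quotmod_scaleA quotmod_scale1 quotmod_scaleDr quotmod_scaleDl.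
End QuotientModule.

Section KernelImage.
Context (A : pzRingType) (M M' : lmodType A) (f : {linear M -> M'}).

Definition linker : {pred M} := [pred x | f x == 0].

Fact linker_submod_closed : submod_closed linker.
Proof.
split; first by rewrite inE linear0.
by move=> a x y; rewrite !inE linearP => /eqP-> /eqP->; rewrite scaler0 addr0.
Qed.

HB.instance Definition _ :=
  GRing.isSubmodClosed.Build A M linker linker_submod_closed.

Definition linimg : {pred M'} := [pred y | `[< exists x, f x = y >]].

Fact linimg_submod_closed : submod_closed linimg.
Proof.
split; first by apply/asboolP; exists 0; rewrite linear0.
move=> a _ _ /asboolP[x <-] /asboolP[y <-].
by apply/asboolP; exists (a *: x + y); rewrite linearP.
Qed.

HB.instance Definition _ :=
  GRing.isSubmodClosed.Build A M' linimg linimg_submod_closed.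
End KernelImage.

Definition endo (A : pzRingType) (M : lmodType A) := {linear M -> M}.

Section EndomorphismRing.
Context (A : pzRingType) (M : lmodType A).
Implicit Types f g h : endo M.

HB.instance Definition _ := gen_eqMixin (endo M).
HB.instance Definition _ := gen_choiceMixin (endo M).

Lemma endoP f g : f =1 g -> f = g.
Proof.
case: f g => [f [[fD] [fZ]]] [g [[gD] [gZ]]] /= /funext eq_fg.
case: _ / eq_fg in gD gZ *.
by rewrite (Prop_irrelevance fD gD) (Prop_irrelevance fZ gZ).
Qed.

Definition endo_zero : endo M := \0.
Definition endo_opp f : endo M := \- f.
Definition endo_add f g : endo M := f \+ g.
Definition endo_one : endo M := idfun.
Definition endo_mul f g : endo M := f \o g.

Fact endo_addA : associative endo_add.
Proof. by move=> f g h; apply: endoP => x /=; rewrite addrA. Qed.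

Fact endo_addC : commutative endo_add.
Proof. by move=> f g; apply: endoP => x /=; rewrite addrC. Qed.

Fact endo_add0 : left_id endo_zero endo_add.
Proof. by move=> f; apply: endoP => x /=; rewrite add0r. Qed.

Fact endo_addN : left_inverse endo_zero endo_opp endo_add.
Proof. by move=> f; apply: endoP => x /=; rewrite addNr. Qed.

HB.instance Definition _ :=
  GRing.isZmodule.Build (endo M) endo_addA endo_addC endo_add0 endo_addN.

Fact endo_mulA : associative endo_mul.
Proof. by move=> f g h; apply: endoP. Qed.

Fact endo_mul1l : left_id endo_one endo_mul.
Proof. by move=> f; apply: endoP. Qed.

Fact endo_mul1r : right_id endo_one endo_mul.
Proof. by move=> f; apply: endoP. Qed.

Fact endo_mulDl : left_distributive endo_mul endo_add.
Proof. by move=> f g h; apply: endoP. Qed.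

Fact endo_mulDr : right_distributive endo_mul endo_add.
Proof. by move=> f g h; apply: endoP => x /=; rewrite linearD. Qed.

HB.instance Definition _ := GRing.Zmodule_isPzRing.Build (endo M)
  endo_mulA endo_mul1l endo_mul1r endo_mulDl endo_mulDr.
End EndomorphismRing.

Definition reduced_ring (T : pzRingType) : Prop :=
  forall (a : T) (n : nat), a ^+ n = 0 -> a = 0.

Definition strongly_regular_ring (T : pzRingType) : Prop :=
  forall a : T, exists y : T, a = a ^+ 2 * y.

Section ModuleProperties.
Context (A : pzRingType).

Definition lmod_isomorphic (U V : lmodType A) : Prop :=
  exists f : {linear U -> V}, bijective f.

Context (M : lmodType A).

Definition finitely_generated (N : submodClosed M) : Prop :=
  exists (n : nat) (g : 'I_n -> M),
    forall x, x \in N <-> exists c : 'I_n -> A, x = \sum_(i < n) c i *: g i.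

Definition direct_summand (N : submodClosed M) : Prop :=
  exists K : submodClosed M,
    (forall x, x \in N -> x \in K -> x = 0) /\
    (forall x, exists y z, [/\ y \in N, z \in K & x = y + z]).

Definition strongly_F_regular : Prop :=
  forall N : submodClosed M, finitely_generated N -> direct_summand N.

Definition morphic : Prop :=
  forall f : {linear M -> M},
    lmod_isomorphic (quotmod (linimg f)) (submod_of (linker f)).

Definition duo : Prop :=
  forall (N : submodClosed M) (f : {linear M -> M}) (x : M),
    x \in N -> f x \in N.

Definition abelian_endoregular : Prop := strongly_regular_ring (endo M).
End ModuleProperties.

(* Main.v *)
Require Import Defs.
From HB Require Import structures.
From mathcomp Require Import all_boot all_algebra.
From mathcomp Require Import boolp.

Set Implicit Arguments.
Unset Strict Implicit.
Unset Printing Implicit Defensive.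

Import GRing.Theory.
Local Open Scope ring_scope.

(** Strong F-regularity enters only through cyclic submodules.

    If [endo M] is reduced, its idempotents are central; a cyclic submodule
    [A x] is the image of an idempotent [e], so every endomorphism [f] satisfies
    [f x = f (e x) = e (f x)], which lies in [A x].  Hence [M] is duo
    ([reduced_endo_duo]).  A strongly regular ring is reduced
    ([strongly_regular_reduced]), so the same argument serves the implication
    from abelian endoregular to duo.

    If [M] is duo, split [M] as [A (f x) (+) K] and write [x = a (f x) + k].
    Both summands are stable under [f], so [f x - a (f (f x)) = f k] lies in
    both and is zero ([duo_image_scale]).  Therefore [f] restricts to an
    automorphism of its image, and inverting it there and killing the kernel
    gives [g] with [f = f ^+ 2 * g] ([duo_abelian_endoregular]).

    Finally, [f = f ^+ 2 * g] in a reduced ring forces [f = g * f ^+ 2], so that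
    [M] is the direct sum of the image and the kernel of [f], and the quotient
    by the image is isomorphic to the kernel
    ([abelian_endoregular_morphic]). *)

(** * Reduced and strongly regular rings *)

Section ReducedRings.
Context (T : pzRingType).

(** Iterating [a = a ^+ 2 * y] gives [a = a ^+ n.+1 * y ^+ n] for all [n]. *)
Lemma strongly_regular_reduced : strongly_regular_ring T -> reduced_ring T.
Proof.
move=> T_reg a n an0; have [y ay] := T_reg a.
have -> : a = a ^+ n.+1 * y ^+ n.
  elim: n {an0} => [|n IHn]; first by rewrite expr1 expr0 mulr1.
  by rewrite -addn2 exprD (exprS y) -mulrA (mulrA (a ^+ 2)) -ay mulrA -exprSr.
by rewrite exprSr an0 !mul0r.
Qed.

(** Both [e * a * (1 - e)] and [(1 - e) * a * e] have square zero. *)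
Lemma reduced_idempotent_central (e a : T) :
  reduced_ring T -> e * e = e -> e * a = a * e.
Proof.
move=> T_red ee.
have e1e : e * (1 - e) = 0 by rewrite mulrBr mulr1 ee subrr.
have ee1 : (1 - e) * e = 0 by rewrite mulrBl mul1r ee subrr.
have eae : e * a = e * a * e.
  apply/eqP; rewrite -subr_eq0 -{1}[e * a]mulr1 -mulrBr; apply/eqP.
  by apply: (T_red _ 2); rewrite expr2 !mulrA -(mulrA (e * a)) ee1 mulr0 !mul0r.
have aee : a * e = e * a * e.
  apply/eqP; rewrite -subr_eq0 -{1}[a * e]mul1r -mulrA -mulrBl; apply/eqP.
  apply: (T_red _ 2).
  by rewrite expr2 mulrA -(mulrA _ _ (1 - e)) -(mulrA a) e1e !mulr0 mul0r.
by rewrite eae aee.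
Qed.

(** First [a - a * y * a], then [a - y * a ^+ 2], has square zero. *)
Lemma reduced_strong_inverse (a y : T) :
  reduced_ring T -> a = a ^+ 2 * y -> a = y * a ^+ 2.
Proof.
move=> T_red; rewrite expr2 => aay.
have xaay x : x * a * a * y = x * a by rewrite -!mulrA (mulrA a a) -aay.
have aya : a * y * a = a.
  apply/esym/eqP; rewrite -subr_eq0; apply/eqP/(T_red _ 2).
  by rewrite expr2 mulrBl !mulrBr !mulrA -aay xaay !subrr.
apply/eqP; rewrite -subr_eq0; apply/eqP/(T_red _ 2).
by rewrite expr2 mulrBl !mulrBr !mulrA aya xaay !subrr.
Qed.

End ReducedRings.

(** * Linear maps and direct sums *)

Section Modules.
Context (A : pzRingType).

(** All the linear maps needed below (projections, partial inverses, the
    isomorphism from a quotient onto a complement) are specified by a property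
    of their values that determines them. *)
Lemma linear_of_graph (U V : lmodType A) (P : U -> V -> Prop) :
    (forall u, exists v, P u v) ->
    (forall u v w, P u v -> P u w -> v = w) ->
    (forall a u1 u2 v1 v2, P u1 v1 -> P u2 v2 ->
       P (a *: u1 + u2) (a *: v1 + v2)) ->
  exists f : {linear U -> V}, forall u, P u (f u).
Proof.
move=> P_tot P_fun P_lin; have [f Pf] := choice P_tot.
have f_lin : linear f.
  by move=> a u v; apply: P_fun (Pf _) _; apply: P_lin.
pose L := GRing.isLinear.Build A U V _ f f_lin.
by exists (HB.pack f L : {linear U -> V}).
Qed.

Context (M : lmodType A).

Definition is_direct_sum (N K : submodClosed M) : Prop :=
  (forall x, x \in N -> x \in K -> x = 0) /\
  (forall x, exists y z, [/\ y \in N, z \in K & x = y + z]).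

Lemma submodB (N : submodClosed M) x y : x \in N -> y \in N -> x - y \in N.
Proof. by move=> Nx Ny; apply: (rpredB (V := M) (S := submod_pred N)). Qed.

Lemma direct_sum_projection {N K : submodClosed M} : is_direct_sum N K ->
  exists e : endo M, (forall x, e x \in N) /\ (forall x, x \in N -> e x = x).
Proof.
case=> NK0 NK.
have [e Pe] : exists e : {linear M -> M}, forall x, e x \in N /\ x - e x \in K.
  apply: (linear_of_graph (P := fun x y => y \in N /\ x - y \in K)).
  - move=> x; have [y [z [Ny Kz ->]]] := NK x; exists y.
    by rewrite addrAC subrr add0r.
  - move=> x y z [Ny Ky] [Nz Kz]; apply/eqP; rewrite -subr_eq0; apply/eqP.
    apply: NK0; first exact: submodB.
    have -> : y - z = (x - z) - (x - y) by rewrite opprB [RHS]addrC addrA subrK.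
    exact: submodB.
  - move=> a x1 x2 y1 y2 [Ny1 Ky1] [Ny2 Ky2]; split.
      by apply: rpredD => //; apply: rpredZ.
    rewrite opprD addrACA -scalerBr.
    by apply: rpredD => //; apply: rpredZ.
exists e; split=> x; first by case: (Pe x).
move=> Nx; have [Nex Kex] := Pe x.
by apply/esym/eqP; rewrite -subr_eq0; apply/eqP/NK0 => //; apply: submodB.
Qed.

Lemma direct_sum_quotient_iso {N K : submodClosed M} : is_direct_sum N K ->
  lmod_isomorphic (quotmod N) (submod_of K).
Proof.
case=> NK0 NK.
have pi_inj (v w : submod_of K) :
    quotmod_pi N (val v) = quotmod_pi N (val w) -> v = w.
  move/eqP; rewrite eq_quotmod_pi => Nvw; apply/val_inj/eqP.
  rewrite -subr_eq0; apply/eqP/NK0 => //.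
  by apply: submodB; apply: submod_valP.
have [f fP] : exists f : {linear quotmod N -> submod_of K},
    forall u, u = quotmod_pi N (val (f u)).
  apply: (linear_of_graph (P := fun u v => u = quotmod_pi N (val v))).
  - move=> u; have [x ->] := quotmod_piP u; have [y [z [Ny Kz ->]]] := NK x.
    exists (SubmodOf Kz); apply/eqP; rewrite eq_quotmod_pi /=.
    by rewrite addrK.
  - by move=> u v w -> /pi_inj.
  - move=> a _ _ v1 v2 -> ->.
    by rewrite linearP quotmod_piD -quotmod_scale_pi.
exists f, (fun v => quotmod_pi N (val v)) => [u|v]; first by rewrite -fP.
by apply: pi_inj; rewrite -fP.
Qed.

(** * Cyclic submodules *)

Definition cyclic_submod (x : M) : {pred M} :=
  [pred y | `[< exists a, y = a *: x >]].

Fact cyclic_submod_closed x : submod_closed (cyclic_submod x).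
Proof.
split; first by apply/asboolP; exists 0; rewrite scale0r.
move=> a _ _ /asboolP[b ->] /asboolP[c ->].
by apply/asboolP; exists (a * b + c); rewrite scalerDl scalerA.
Qed.

HB.instance Definition _ x :=
  GRing.isSubmodClosed.Build A M (cyclic_submod x) (cyclic_submod_closed x).

Lemma mem_cyclic_submod x : x \in cyclic_submod x.
Proof. by apply/asboolP; exists 1; rewrite scale1r. Qed.

Lemma sFr_cyclic_summand x : strongly_F_regular M ->
  exists K : submodClosed M, is_direct_sum (cyclic_submod x) K.
Proof.
apply; exists 1, (fun=> x) => y; split.
  by move/asboolP=> [a ->]; exists (fun=> a); rewrite big_ord1.
by case=> c ->; rewrite big_ord1; apply/asboolP; exists (c ord0).
Qed.

(** * The equivalences *)

(** Cyclic submodules are images of idempotents, which are central. *)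
Lemma reduced_endo_duo :
  strongly_F_regular M -> reduced_ring (endo M) -> duo M.
Proof.
move=> M_sFr S_red N f x Nx; have [K /direct_sum_projection] :=
  sFr_cyclic_summand x M_sFr.
case=> e [e_in e_id].
have ee : e * e = e by apply: endoP => y; apply: e_id.
have ef : e (f x) = f (e x).
  have /(congr1 (fun g : endo M => g x)) : e * (f : endo M) = (f : endo M) * e.
    exact: reduced_idempotent_central.
  by [].
rewrite -(e_id x (mem_cyclic_submod x)) -ef.
by have /asboolP[a ->] := e_in (f x); apply: rpredZ.
Qed.

(** Splitting [x] along a decomposition of [M] into [A (f x)] and a complement,
    both stable under [f]. *)
Lemma duo_image_scale (f : endo M) x :
  strongly_F_regular M -> duo M -> exists a, f x = a *: f (f x).
Proof.
move=> M_sFr M_duo; have [K [CK0 CK]] := sFr_cyclic_summand (f x) M_sFr.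
have [_ [k [/asboolP[a ->] Kk x_eq]]] := CK x.
have fx_eq : f x = a *: f (f x) + f k by rewrite {1}x_eq linearP.
suff fk0 : f k = 0 by exists a; rewrite {1}fx_eq fk0 addr0.
apply: CK0; last exact: M_duo.
have -> : f k = f x - a *: f (f x) by rewrite {1}fx_eq addrAC subrr add0r.
apply: submodB; first exact: mem_cyclic_submod.
by apply: rpredZ; apply: M_duo; apply: mem_cyclic_submod.
Qed.

(** The map [g] with [f = f ^+ 2 * g] sends [u] to the only [z] in the image of
    [f] such that [f (f z) = f u]. *)
Lemma duo_abelian_endoregular :
  strongly_F_regular M -> duo M -> abelian_endoregular M.
Proof.
move=> M_sFr M_duo f.
have f_scale x := duo_image_scale f x M_sFr M_duo.
have ker_f2 t : f (f t) = 0 -> f t = 0.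
  by move=> fft0; have [a ->] := f_scale t; rewrite fft0 scaler0.
have [g Pg] : exists g : {linear M -> M}, forall u,
    (exists t, g u = f t) /\ f (f (g u)) = f u.
  apply: (linear_of_graph
            (P := fun u z => (exists t, z = f t) /\ f (f z) = f u)).
  - move=> u; have [a fu] := f_scale u; have [b ffu] := f_scale (f u).
    exists (a *: (b *: f u)); split; last by rewrite !linearZ /= -ffu -fu.
    by exists (a *: (b *: u)); rewrite !linearZ.
  - move=> u _ _ [[s ->] fs] [[t ->] ft].
    apply/eqP; rewrite -subr_eq0 -linearB; apply/eqP/ker_f2/ker_f2.
    by rewrite !linearB /= fs ft subrr.
  - move=> a u1 u2 _ _ [[t1 ->] ft1] [[t2 ->] ft2]; split.
      by exists (a *: t1 + t2); rewrite linearP.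
    by rewrite !linearP /= ft1 ft2.
by exists g; apply: endoP => u; case: (Pg u) => _ <-.
Qed.

(** With [f = f ^+ 2 * g = g * f ^+ 2], the first equality puts [x - f (g x)] in
    the kernel of [f] and the second makes the kernel meet the image in zero. *)
Lemma abelian_endoregular_morphic : abelian_endoregular M -> morphic M.
Proof.
move=> S_reg f; have [g fg] := S_reg f.
have gf := reduced_strong_inverse (strongly_regular_reduced S_reg) fg.
have ffg x : f (f (g x)) = f x.
  by rewrite [in RHS](congr1 (fun h : endo M => h x) fg).
have gff x : g (f (f x)) = f x.
  by rewrite [in RHS](congr1 (fun h : endo M => h x) gf).
apply: direct_sum_quotient_iso; split.
  by move=> _ /asboolP[x <-] /eqP ffx0; rewrite -gff ffx0 linear0.
move=> x; exists (f (g x)), (x - f (g x)); split.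
- by apply/asboolP; exists (g x).
- by apply/eqP; rewrite linearB /= ffg subrr.
- by rewrite addrC subrK.
Qed.

End Modules.

Theorem theorem3 (R : pzRingType) (M : lmodType R^c)
    (M_neq0 : exists x : M, x != 0) (M_sFr : strongly_F_regular M) :
  ((morphic M /\ reduced_ring (endo M)) <-> duo M) /\
  (duo M <-> abelian_endoregular M).
Proof.
have duo_reg := duo_abelian_endoregular M_sFr.
split; split=> //.
- by case=> _; apply: reduced_endo_duo.
- move/duo_reg=> S_reg; split; first exact: abelian_endoregular_morphic.
  exact: strongly_regular_reduced.
- by move/strongly_regular_reduced; apply: reduced_endo_duo.
Qed.
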